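(* Let $\boldsymbol{X}=(X_1,\ldots,X_d)\sim \mathcal{N}_d(\boldsymbol{0}_d,\Sigma)$ for some positive definite $d\times d$ matrix $\Sigma$, and let $\emptyset\neq\mathcal{J}\subsetneq\{1,\ldots,d\}$ be given, with complement $\mathcal{J}^{\complement}=\{1,\ldots,d\}\setminus\mathcal{J}$. Assume that $\nu_j\in[0,1/2)$ for all $j\in\mathcal{J}$ and $\nu_i\in(0,\infty)$ for all $i\in\mathcal{J}^{\complement}$. Assume moreover that the statement $\mathbf{GPI}_{d-|\mathcal{J}|}((\nu_i)_{i\in\mathcal{J}^{\complement}})$ is true. Then $$ \mathsf{E}\left[\prod_{j\in\mathcal{J}}|X_j|^{-2\nu_j}\times\prod_{i\in\mathcal{J}^{\complement}}|X_i|^{2\nu_i}\right] \geq \mathsf{E}\left[\prod_{j\in\mathcal{J}}|X_j|^{-2\nu_j}\right]\times\prod_{i\in\mathcal{J}^{\complement}}\left\{\frac{(\Sigma/\Sigma_{\mathcal{J}\mathcal{J}})_{ii}}{\Sigma_{ii}}\right\}^{\nu_i}\mathsf{E}\left[|X_i|^{2\nu_i}\right]. $$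
   Context: $\mathcal{N}_d(\boldsymbol{0}_d,\Sigma)$ is the centered Gaussian law on $\mathbb{R}^d$ with covariance matrix $\Sigma$; positive definite matrices are symmetric. Gaussian product inequality: for $n\in\mathbb{N}$ and $\boldsymbol{\nu}=(\nu_1,\ldots,\nu_n)\in(0,\infty)^n$, the statement $\mathbf{GPI}_n(\boldsymbol{\nu})$ asserts that for every real centered Gaussian random vector $(Z_1,\ldots,Z_n)$, $$\mathsf{E}\left[\prod_{i=1}^n|Z_i|^{2\nu_i}\right]\geq\prod_{i=1}^n\mathsf{E}\left[|Z_i|^{2\nu_i}\right].$$ When the exponents are indexed by a set $\mathcal{J}^{\complement}$ of size $n$, the statement is understood for vectors indexed by $\mathcal{J}^{\complement}$. For index sets $\mathcal{I},\mathcal{I}'\subseteq\{1,\ldots,d\}$, $\Sigma_{\mathcal{I}\mathcal{I}'}$ denotes $\Sigma$ restricted to the rows indexed by $\mathcal{I}$ and the columns indexed by $\mathcal{I}'$. The Schur complement of $\Sigma_{\mathcal{J}\mathcal{J}}$ in $\Sigma$ is $$\Sigma/\Sigma_{\mathcal{J}\mathcal{J}}=\Sigma_{\mathcal{J}^{\complement}\mathcal{J}^{\complement}}-\Sigma_{\mathcal{J}^{\complement}\mathcal{J}}\,\Sigma_{\mathcal{J}\mathcal{J}}^{-1}\,\Sigma_{\mathcal{J}\mathcal{J}^{\complement}},$$ a matrix with rows and columns indexed by $\mathcal{J}^{\complement}$; in $(\Sigma/\Sigma_{\mathcal{J}\mathcal{J}})_{ii}$ the index $i$ is the original index in $\mathcal{J}^{\complement}$.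 *)

(* Defs.v *)
From HB Require Import structures.
From mathcomp Require Export all_boot all_order all_algebra.
From mathcomp Require Export all_classical all_reals all_analysis.

#[export] Set Implicit Arguments.
#[export] Unset Strict Implicit.
#[export] Unset Printing Implicit Defensive.

Export Order.TTheory GRing.Theory Num.Theory numFieldNormedType.Exports.

#[global] Open Scope classical_set_scope.
#[global] Open Scope ring_scope.

(** Mutual independence of a whole finite family.  Since every [B i] may be
    the full line, this contains the product rule for all subfamilies. *)
Definition independent_RVs {dsp : measure_display} {T : measurableType dsp}
    {R : realType} {P : probability T R} {k : nat}
    (Z : 'I_k -> {RV P >-> R}) : Prop :=
  forall B : 'I_k -> set R, (forall i, measurable (B i)) ->
    P (\bigcap_i (Z i @^-1` B i)) =
    (\prod_(i < k) P (Z i @^-1` B i))%E.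

(** [Z] is a standard normal vector: i.i.d. coordinates of law N(0, 1).  The
    second parameter of [normal_prob] is the standard deviation. *)
Definition standard_gaussian {dsp : measure_display} {T : measurableType dsp}
    {R : realType} {P : probability T R} {k : nat}
    (Z : 'I_k -> {RV P >-> R}) : Prop :=
  independent_RVs Z /\
  forall i (B : set R), measurable B ->
    distribution P (Z i) B = normal_prob 0 1 B.

(** [X] has the centered Gaussian law with covariance [Sigma]: almost surely
    [X = A Z] with [Z] a standard normal vector of some dimension [k] and
    [A A^T = Sigma].  Singular [Sigma] is allowed (with [k = 0] for
    [Sigma = 0]).  Asking for [Z] on the same probability space as [X] loses
    nothing: a centered Gaussian [X] whose covariance has rank [k] is [A Z] for
    some [A] of full column rank, and then [Z] is a linear function of [X]. *)
Definition centered_gaussian {dsp : measure_display} {T : measurableType dsp}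
    {R : realType} {P : probability T R} {n : nat}
    (X : 'I_n -> {RV P >-> R}) (Sigma : 'M[R]_n) : Prop :=
  exists (k : nat) (A : 'M[R]_(n, k)) (Z : 'I_k -> {RV P >-> R}),
    [/\ standard_gaussian Z,
        A *m A^T = Sigma &
        {ae P, forall w, forall i, X i w = \sum_(j < k) A i j * Z j w}].

Definition posdefmx {R : realType} {n : nat} (Sigma : 'M[R]_n) : Prop :=
  Sigma^T = Sigma /\
  forall v : 'cV[R]_n, v != 0 -> 0 < (v^T *m Sigma *m v) 0 0.

(** Expectations are extended-real valued, so no integrability is needed. *)
Definition GPI (R : realType) (n : nat) (nu : 'I_n -> R) : Prop :=
  forall (dsp : measure_display) (T : measurableType dsp)
    (P : probability T R) (Z : 'I_n -> {RV P >-> R}) (Sigma : 'M[R]_n),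
  centered_gaussian Z Sigma ->
  (\prod_(i < n) 'E_P[fun w => (`|Z i w| `^ (2 * nu i))%R] <=
   'E_P[fun w => (\prod_(i < n) `|Z i w| `^ (2 * nu i))%R])%E.

(** Rows and columns are renumbered by the increasing enumerations
    [enum_val : 'I_#|I| -> 'I_d] of the index sets. *)
Definition restrictmx {R : realType} {d : nat} (I I' : {set 'I_d})
    (Sigma : 'M[R]_d) : 'M[R]_(#|I|, #|I'|) :=
  mxsub (enum_val (A := I)) (enum_val (A := I')) Sigma.

Definition schur_complement {R : realType} {d : nat} (Sigma : 'M[R]_d)
    (J : {set 'I_d}) : 'M[R]_#|~: J| :=
  restrictmx (~: J) (~: J) Sigma -
  restrictmx (~: J) J Sigma *m invmx (restrictmx J J Sigma)
    *m restrictmx J (~: J) Sigma.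

(* Main.v *)
(* By [|x|^(-2 nu) = C int exp(nu u - x^2 e^u) du], negative powers of the
   [X_j], [j in J], are mixtures of the weights [exp(- s X_j^2)].  Normalising
   such a weight to a change of probability keeps [X] centered Gaussian and turns
   the covariance [S] into [S - c S e_j e_j^T S] with [c S_jj < 1]; this does not
   lower any variance below the minimum of [Var(X_i + sum_(j in J) w_j X_j)]
   over [w], which is the diagonal entry of the Schur complement.  Under every
   tilted law the Gaussian product inequality bounds [E prod |X_i|^(2 nu_i)] by
   the product of the moments, each of which grows with the variance; integrating
   over the mixtures gives the theorem.  Rotation invariance, which reduces a
   tilt to a one-dimensional dilation, is obtained from plane rotations. *)
From HB Require Import structures.
Require Import Defs.
From mathcomp Require Import measurable_realfun ring lra.

(** * Densities and affine changes of variable *)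

Section density.
Local Open Scope ereal_scope.
Context d (T : measurableType d) (R : realType).
Variables (mu nu : {measure set T -> \bar R}) (f : T -> R).
Hypotheses (mf : measurable_fun setT f) (f0 : forall x, (0 <= f x)%R).
Hypothesis nuE : forall B, measurable B -> nu B = \int[mu]_(x in B) (f x)%:E.

Let mfE : measurable_fun setT (EFin \o f).
Proof. exact/measurable_EFinP. Qed.

Import HBNNSimple.

(** Monotone convergence along the simple approximations [h n] reduces the identity to indicators of
    their fibres, where it is [nuE]. The measure [nu] is known only through its values, so the
    result serves for the normal law, for restrictions of [P] and for tilted laws. *)
Lemma ge0_integral_density (g : T -> \bar R) :
  measurable_fun setT g -> (forall x, 0 <= g x) ->
  \int[nu]_x g x = \int[mu]_x ((f x)%:E * g x).
Proof.
move=> mg g0; pose h := nnsfun_approx measurableT mg.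
have gE x : g x = limn (fun n => (h n x)%:E).
  by apply/esym/cvg_lim => //; exact: cvg_nnsfun_approx.
have mh n : measurable_fun setT (fun x => (h n x)%:E).
  by apply/measurable_EFinP/measurable_funP.
have -> : \int[nu]_x g x = limn (fun n => \int[nu]_x (h n x)%:E).
  rewrite -monotone_convergence//.
  - by apply: eq_integral => x _; exact: gE.
  - by move=> n x _; rewrite lee_fin.
  - by move=> x _ a b ab; rewrite lee_fin; exact/lefP/nd_nnsfun_approx.
have -> : \int[mu]_x ((f x)%:E * g x) =
    limn (fun n => \int[mu]_x ((f x)%:E * (h n x)%:E)).
  rewrite -monotone_convergence//.
  - apply: eq_integral => x _; rewrite gE.
    have hx : (fun n => (h n x)%:E) @ \oo --> limn (fun n => (h n x)%:E).
      by rewrite -gE; exact: cvg_nnsfun_approx.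
    apply/esym/cvg_lim => //.
    by apply: cvgeZl.
  - by move=> n; exact: emeasurable_funM.
  - by move=> n x _; rewrite mule_ge0 ?lee_fin ?f0.
  - move=> x _ a b ab; apply: lee_wpmul2l; rewrite lee_fin//.
    exact/lefP/nd_nnsfun_approx.
congr (limn _); apply/funext => n.
rewrite integralT_nnsfun sintegralE.
under [RHS]eq_integral => x _.
  rewrite fimfunE -fsumEFin// ge0_mule_fsumr; last first.
    by move=> r; rewrite nnfun_muleindic_ge0.
  over.
have mh1 r : measurable (h n @^-1` [set r]).
  by rewrite -[X in measurable X]setTI; exact: measurable_funP.
rewrite ge0_integral_fsum//; last 2 first.
- move=> r; apply: emeasurable_funM => //.
  by apply/measurable_EFinP/measurable_funM.
- move=> r x _; apply: mule_ge0; first by rewrite lee_fin.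
  by rewrite EFinM nnfun_muleindic_ge0.
apply: eq_fsbigr => r; rewrite inE => -[x _ <-].
under eq_integral do rewrite EFinM muleCA.
rewrite ge0_integralZl//.
- rewrite nuE//; congr (_ * _); rewrite [LHS]integral_mkcond.
  by apply: eq_integral => y _; rewrite epatch_indic.
- by apply: emeasurable_funM => //; apply/measurable_EFinP.
- by move=> y _; rewrite mule_ge0 ?lee_fin// lee_fin.
- by rewrite lee_fin.
Qed.
End density.

Section density_measure.
Local Open Scope ereal_scope.
Context d (T : measurableType d) (R : realType).
Variables (mu : {measure set T -> \bar R}) (f : T -> R).
Hypotheses (mf : measurable_fun setT f) (f0 : forall x, (0 <= f x)%R).
Hypothesis f1 : \int[mu]_x (f x)%:E = 1.

Let nu (B : set T) : \bar R := \int[mu]_(x in B) (f x)%:E.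

Lemma probability_density :
  exists Q : probability T R, forall B, Q B = \int[mu]_(x in B) (f x)%:E.
Proof.
have fE0 x : 0 <= (f x)%:E by rewrite lee_fin.
have nu0 : nu set0 = 0 by exact: integral_set0.
have nu_ge0 B : 0 <= nu B by exact: integral_ge0.
have nus : semi_sigma_additive nu.
  move=> F mF tF mUF; rewrite /nu ge0_integral_bigcup//=; last first.
    by apply/measurable_EFinP; exact: measurable_funTS.
  by apply: is_cvg_ereal_nneg_natsum_cond => // n _ _; exact: integral_ge0.
pose m : {measure set T -> \bar R} :=
  HB.pack nu (isMeasure.Build _ _ _ nu nu0 nu_ge0 nus).
pose Q : probability T R := HB.pack nu
  (isMeasure.Build _ _ _ nu nu0 nu_ge0 nus)
  (Measure_isProbability.Build _ _ R m f1).
by exists Q.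
Qed.
End density_measure.

Section pushforward.
Local Open Scope ereal_scope.
Context d d' (T : measurableType d) (T' : measurableType d') (R : realType).

(** Packaged existentially, so that later proofs handle a measure known only by its values and its
    integrals. *)
Lemma pushforward_measure (mu : {measure set T -> \bar R}) (f : T -> T') :
  measurable_fun setT f ->
  exists2 nu : {measure set T' -> \bar R},
    (forall B, nu B = mu (f @^-1` B)) &
    (forall g : T' -> \bar R, measurable_fun setT g -> (forall y, 0 <= g y) ->
      \int[nu]_y g y = \int[mu]_x g (f x)).
Proof.
move=> mf.
unshelve refine (ex_intro2 _ _ (Measure.clone _ _ _ (pushforward mu f) _) _ _).
- exact: mf.
- by [].
- by move=> g mg g0; rewrite ge0_integral_pushforward.
Qed.
End pushforward.

Section affine.
Local Open Scope ereal_scope.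
Context (R : realType).
Local Notation mu := (@lebesgue_measure R).

(** By uniqueness of Lebesgue measure, half-open intervals suffice. A negative [a] reverses the
    preimage and moves its closed end to the left, which does not affect the length. *)
Lemma lebesgue_measure_affine (a b : R) (B : set R) : a != 0%R -> measurable B ->
  mu B = `|a|%:E * mu ((fun x => a * x + b)%R @^-1` B).
Proof.
move=> a0 mB.
have mphi : measurable_fun setT (fun x : R => a * x + b)%R.
  by apply: measurable_funD => //; exact: measurable_funM.
have [nu nuE _] := pushforward_measure (T' := measurableTypeR R) mu mphi.
rewrite -nuE; pose m := mscale (NngNum (normr_ge0 a)) nu.
change (mu B = m B).
apply: (@lebesgue_measure_unique R m) => // _ [[x y] _ <-] /=.
rewrite /m /mscale nuE/=.
have [agt0|alt0|] := ltgtP 0%R a; last by move/esym/eqP; rewrite (negbTE a0).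
- rewrite (_ : _ @^-1` _ = `](x - b) / a, (y - b) / a]%classic)%R; last first.
    apply/seteqP; split => z/=; rewrite !in_itv/= ltr_pdivrMr// ler_pdivlMr//;
    by rewrite ltrBlDr lerBrDr (mulrC z).
  rewrite !lebesgue_measure_itv/= !lte_fin gtr0_norm//.
  rewrite ltr_pM2r ?invr_gt0// ltrD2r; case: ifP => _; last by rewrite mule0.
  by rewrite -!EFinD -EFinM; congr EFin; field.
- rewrite (_ : _ @^-1` _ = `[(y - b) / a, (x - b) / a[%classic)%R; last first.
    apply/seteqP; split => z/=; rewrite !in_itv/= ler_ndivrMr// ltr_ndivlMr//;
    by rewrite ltrBlDr lerBrDr (mulrC z) andbC.
  rewrite !lebesgue_measure_itv/= !lte_fin ltr0_norm//.
  rewrite ltr_nM2r ?invr_lt0// ltrD2r; case: ifP => _; last by rewrite mule0.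
  by rewrite -!EFinD -EFinM; congr EFin; field.
Qed.

Lemma ge0_integral_affine (a b : R) (g : R -> \bar R) : a != 0%R ->
  measurable_fun setT g -> (forall x, 0 <= g x) ->
  \int[mu]_x g x = `|a|%:E * \int[mu]_x g (a * x + b)%R.
Proof.
move=> a0 mg g0.
have mphi : measurable_fun setT (fun x : R => a * x + b)%R.
  by apply: measurable_funD => //; exact: measurable_funM.
have [nu nuE nuI] := pushforward_measure (T' := measurableTypeR R) mu mphi.
pose m := mscale (NngNum (normr_ge0 a)) nu.
transitivity (\int[m]_x g x).
  apply: eq_measure_integral => B mB _.
  by rewrite [LHS](lebesgue_measure_affine b a0 mB) -nuE.
by rewrite ge0_integral_mscale//= nuI.
Qed.
End affine.

(** * Rotation and dilation of the standard normal law *)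

Section rotation.
Local Open Scope ereal_scope.
Context (R : realType).
Local Notation mu := (@lebesgue_measure R).

Lemma measurable_lin2 (a b : R) :
  measurable_fun setT (fun z : R * R => a * z.1 + b * z.2)%R.
Proof.
apply: measurable_funD; apply: measurable_funM => //.
Qed.

Lemma measurable_lin2_pair (a b a' b' : R) :
  measurable_fun setT
    (fun z : R * R => (a * z.1 + b * z.2, a' * z.1 + b' * z.2)%R).
Proof. by apply: measurable_fun_pair; exact: measurable_lin2. Qed.

(* With the second variable frozen, the rotation acts on the first one as a
   dilation by [c] and a translation; after this substitution the second
   variable undergoes the inverse dilation.  Hence the hypothesis [c != 0]. *)
Lemma lebesgue_rotation (c s : R) (h : R * R -> \bar R) :
  c != 0%R -> (c ^+ 2 + s ^+ 2 = 1)%R ->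
  measurable_fun setT h -> (forall z, 0 <= h z) ->
  \int[mu]_x \int[mu]_y h (c * x + s * y, - s * x + c * y)%R =
  \int[mu]_x \int[mu]_y h (x, y).
Proof.
move=> c0 cs1 mh h0.
have c20 : (`|c| != 0)%R by rewrite normr_eq0.
have mlin a b a' b' : measurable_fun setT
    (fun z : R * R => h (a * z.1 + b * z.2, a' * z.1 + b' * z.2)%R).
  exact: (measurableT_comp mh (measurable_lin2_pair a b a' b')).
have /= -> := fubini_tonelli (m1 := mu) (m2 := mu) _ (mlin c s (- s)%R c)
  (fun z => h0 _).
transitivity (\int[mu]_y
    (`|c|^-1%:E * \int[mu]_u h (u, c^-1 * y + - (s / c) * u)%R)).
  apply: eq_integral => y _.
  have mhy : measurable_fun setT (fun u => h (u, c^-1 * y + - (s / c) * u)%R).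
    apply: (measurableT_comp mh); apply: measurable_fun_pair => //=.
    by apply: measurable_funD => //; exact: measurable_funM.
  rewrite (ge0_integral_affine (s * y) c0 mhy)// muleA -EFinM mulVf// mul1e.
  apply: eq_integral => x _; congr (h (_, _)).
  (* The coefficient [c] of [y] is expanded so that [cs1] turns it into (1 - s^2) / c. *)
  transitivity (- s * x + c^-1 * (c ^+ 2 + s ^+ 2 - s ^+ 2) * y)%R.
    by field.
  by rewrite cs1; field.
have mK : measurable_fun setT
    (fun z : R * R => h (z.1, c^-1 * z.2 + - (s / c) * z.1)%R).
  apply: (measurableT_comp mh); apply: measurable_fun_pair => //.
  by under eq_fun do rewrite addrC; exact: measurable_lin2.
rewrite ge0_integralZl//; last 2 first.
- exact: (measurable_fun_fubini_tonelli_G (m1 := mu) _ mK (fun z => h0 _)).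
- by move=> y _; exact: integral_ge0.
have /= <- := fubini_tonelli (m1 := mu) (m2 := mu) _ mK (fun z => h0 _).
rewrite -ge0_integralZl//; last 2 first.
- exact: (measurable_fun_fubini_tonelli_F (m2 := mu) _ mK (fun z => h0 _)).
- by move=> y _; exact: integral_ge0.
apply: eq_integral => x _.
have cV0 : (c^-1 != 0)%R by rewrite invr_eq0.
rewrite [RHS](ge0_integral_affine (- (s / c) * x) cV0)//; last first.
  by apply: (measurableT_comp mh); exact: measurable_pair1.
by rewrite normfV.
Qed.
End rotation.

Section normal.
Local Open Scope ereal_scope.
Context (R : realType).
Local Notation mu := (@lebesgue_measure R).
Local Notation N := (normal_prob (0 : R) 1).

Lemma normal_pdf01E (x : R) :
  (normal_pdf 0 1 x = normal_peak 1 * expR (- x ^+ 2 / 2))%R.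
Proof. by rewrite normal_pdfE ?oner_eq0// /normal_fun subr0 expr1n. Qed.

Lemma ge0_integral_normal (g : R -> \bar R) :
  measurable_fun setT g -> (forall x, 0 <= g x) ->
  \int[N]_x g x = \int[mu]_x ((normal_pdf 0 1 x)%:E * g x).
Proof.
move=> mg g0; apply: ge0_integral_density => //.
- exact: measurable_normal_pdf.
- by move=> x; exact: normal_pdf_ge0.
Qed.

(** The product density depends on x^2 + y^2 only, which the rotation preserves, so
    [lebesgue_rotation] applies to [h] times this density. *)
Lemma normal_rotation (c s : R) (h : R * R -> \bar R) :
  c != 0%R -> (c ^+ 2 + s ^+ 2 = 1)%R ->
  measurable_fun setT h -> (forall z, 0 <= h z) ->
  \int[N]_x \int[N]_y h (c * x + s * y, - s * x + c * y)%R =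
  \int[N]_x \int[N]_y h (x, y).
Proof.
move=> c0 cs1 mh h0.
have mpdf : measurable_fun setT (fun x : R => (normal_pdf 0 1 x)%:E).
  by apply/measurable_EFinP; exact: measurable_normal_pdf.
have pdf0 (x : R) : 0 <= (normal_pdf 0 1 x)%:E.
  by rewrite lee_fin normal_pdf_ge0.
have mw : measurable_fun setT
    (fun z : R * R => (normal_pdf 0 1 z.1)%:E * (normal_pdf 0 1 z.2)%:E).
  by apply: emeasurable_funM; exact: (measurableT_comp mpdf).
pose H z := ((normal_pdf 0 1 z.1)%:E * (normal_pdf 0 1 z.2)%:E * h z).
have NE (g : R * R -> \bar R) : measurable_fun setT g -> (forall z, 0 <= g z) ->
  \int[N]_x \int[N]_y g (x, y) =
  \int[mu]_x \int[mu]_y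
    ((normal_pdf 0 1 x)%:E * (normal_pdf 0 1 y)%:E * g (x, y)).
  move=> mg g0.
  rewrite ge0_integral_normal//; last 2 first.
  - exact: (measurable_fun_fubini_tonelli_F (m2 := N) _ mg g0).
  - by move=> x; exact: integral_ge0.
  have mgx x : measurable_fun setT (fun y => g (x, y)).
    by apply: (measurableT_comp mg); exact: pair1_measurable.
  apply: eq_integral => x _; rewrite ge0_integral_normal//.
  rewrite -ge0_integralZl//; last 2 first.
  - exact: (emeasurable_funM mpdf (mgx x)).
  - by move=> y _; exact: mule_ge0.
  by apply: eq_integral => y _; rewrite muleA.
have mH : measurable_fun setT H by exact: emeasurable_funM.
have H0 z : 0 <= H z by rewrite !mule_ge0.
rewrite [LHS](NE (fun z => h (c * z.1 + s * z.2, - s * z.1 + c * z.2)%R))//;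
  last first.
  exact: (measurableT_comp mh (measurable_lin2_pair _ _ _ _)).
rewrite NE//.
transitivity (\int[mu]_x \int[mu]_y H (c * x + s * y, - s * x + c * y)%R).
  apply: eq_integral => x _; apply: eq_integral => y _.
  rewrite /H/=; congr (_ * _); rewrite -!EFinM !normal_pdf01E; congr EFin.
  rewrite !mulrA ![(normal_peak 1 * _ * normal_peak 1)%R]mulrAC -!mulrA -!expRD.
  have -> : (x ^+ 2 = (c ^+ 2 + s ^+ 2) * x ^+ 2)%R by rewrite cs1 mul1r.
  have -> : (y ^+ 2 = (c ^+ 2 + s ^+ 2) * y ^+ 2)%R by rewrite cs1 mul1r.
  by do 2 congr (_ * _)%R; congr expR; field.
by rewrite lebesgue_rotation.
Qed.

(** With a^2 = 1 + 2t, the weight exp(-t x^2) times the normal density at x is the normal density at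
    a x; substituting a x for x leaves the Jacobian 1 / a. *)
Lemma normal_tilt (t : R) (g : R -> \bar R) : (0 <= t)%R ->
  measurable_fun setT g -> (forall x, 0 <= g x) ->
  \int[N]_x ((expR (- t * x ^+ 2))%:E * g (Num.sqrt (1 + 2 * t) * x)%R) =
  (Num.sqrt (1 + 2 * t))^-1%:E * \int[N]_x g x.
Proof.
move=> t0 mg g0; set a := Num.sqrt _.
have a2 : (a ^+ 2 = 1 + 2 * t)%R by rewrite sqr_sqrtr//; lra.
have agt0 : (0 < a)%R by rewrite sqrtr_gt0; lra.
have mga : measurable_fun setT (fun x => g (a * x)%R).
  by apply: (measurableT_comp mg); exact: measurable_funM.
have me : measurable_fun setT (fun x : R => (expR (- t * x ^+ 2))%:E).
  apply/measurable_EFinP; apply: measurableT_comp => //.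
  by apply: measurable_funM => //; exact: measurable_funX.
rewrite ge0_integral_normal//; last 2 first.
- exact: emeasurable_funM.
- by move=> x; rewrite mule_ge0// lee_fin expR_ge0.
rewrite ge0_integral_normal//.
rewrite [X in _ * X](ge0_integral_affine (a := a) 0)//; last 3 first.
- by rewrite gt_eqF.
- apply: emeasurable_funM => //; apply/measurable_EFinP.
  exact: measurable_normal_pdf.
- by move=> x; rewrite mule_ge0// lee_fin normal_pdf_ge0.
rewrite gtr0_norm// muleA -EFinM mulVf ?gt_eqF// mul1e.
apply: eq_integral => x _; rewrite addr0 muleA -EFinM; congr (_%:E * _).
rewrite !normal_pdf01E -mulrA -expRD exprMn a2; congr (_ * expR _)%R.
by field.
Qed.

End normal.

(** * Negative powers as mixtures of Gaussian weights *)

Section gamma.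
Local Open Scope ereal_scope.
Context (R : realType).
Local Notation mu := (@lebesgue_measure R).

Lemma measurable_gamma_integrand (nu a : R) :
  measurable_fun setT (fun u : R => (expR (nu * u - a * expR u))%:E).
Proof.
apply/measurable_EFinP; apply: measurableT_comp => //.
by apply: measurable_funB; exact: measurable_funM.
Qed.

(** This integrable majorant makes the gamma integral below finite. On each half-line the integrand
    is 1 / a times an exponential density, reflected on the negative side. *)
Lemma integral_expRNnorm_lty (a : R) : (0 < a)%R ->
  \int[mu]_u (expR (- a * `|u|))%:E < +oo.
Proof.
move=> a0.
have mpdf : measurable_fun setT (fun x : R => (exponential_pdf a x)%:E).
  by apply/measurable_EFinP; exact: measurable_exponential_pdf.
have pdf0 x : 0 <= (exponential_pdf a x)%:E.
  by rewrite lee_fin exponential_pdf_ge0// ltW.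
have mpdfN : measurable_fun setT (fun x : R => (exponential_pdf a (- x)%R)%:E).
  by apply: (measurableT_comp mpdf).
have ir : \int[mu]_x (exponential_pdf a (- x)%R)%:E = 1.
  rewrite -(integral_exponential_pdf a0).
  rewrite [RHS](ge0_integral_affine (a := (-1)%R) 0%R)//.
  rewrite normrN1 mul1e; apply: eq_integral => x _.
  by rewrite mulN1r addr0.
apply: (@le_lt_trans _ _ (\int[mu]_u
    (a^-1%:E * ((exponential_pdf a u)%:E + (exponential_pdf a (- u)%R)%:E)))).
  apply: ge0_le_integral => //.
  - apply/measurable_EFinP; apply: measurableT_comp => //.
    by apply: measurable_funM => //; exact: measurableT_comp.
  - by apply: emeasurable_funM => //; exact: emeasurable_funD.
  - move=> u _; have [u0|u0] := leP 0%R u.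
      apply: (@le_trans _ _ (a^-1%:E * (exponential_pdf a u)%:E)).
        by rewrite exponential_pdfE// -EFinM mulKf ?gt_eqF// ger0_norm.
      apply: lee_wpmul2l; first by rewrite lee_fin invr_ge0 ltW.
      exact: leeDl.
    apply: (@le_trans _ _ (a^-1%:E * (exponential_pdf a (- u)%R)%:E)).
      rewrite exponential_pdfE ?oppr_ge0 ?(ltW u0)//.
      by rewrite -EFinM mulKf ?gt_eqF// ltr0_norm.
    apply: lee_wpmul2l; first by rewrite lee_fin invr_ge0 ltW.
    exact: leeDr.
rewrite ge0_integralZl//; last 3 first.
- exact: emeasurable_funD.
- by move=> u _; exact: adde_ge0.
- by rewrite lee_fin invr_ge0 ltW.
by rewrite ge0_integralD// ir integral_exponential_pdf// -EFinD -EFinM ltry.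
Qed.

(** With v = e^u the integral is that of v^(nu - 1) e^(- x^2 v), so [C] is the inverse of Gamma(nu).
    In the variable u, the scaling of v by x^2 becomes a translation of the whole line. *)
Lemma powRN_gamma (nu : R) : (0 < nu < 2^-1)%R ->
  exists2 C : R, (0 < C)%R & forall x : R, x != 0%R ->
    (`|x| `^ (- (2 * nu)))%:E =
    C%:E * \int[mu]_u (expR (nu * u - x ^+ 2 * expR u))%:E.
Proof.
move=> /andP[nu0 nu1].
pose G := \int[mu]_u (expR (nu * u - 1 * expR u))%:E.
have Gfin : G < +oo.
  apply: le_lt_trans (integral_expRNnorm_lty nu0).
  apply: ge0_le_integral => //.
  - exact: measurable_gamma_integrand.
  - apply/measurable_EFinP; apply: measurableT_comp => //.
    by apply: measurable_funM => //; exact: measurableT_comp.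
  - move=> u _; rewrite lee_fin ler_expR mul1r.
    (* For u >= 0 the bound amounts to 2 nu u <= e^u, which follows from nu < 1/2 and 1 + u <=
       e^u. *)
    have [u0|u0] := leP 0%R u.
      have := expR_ge1Dx u; rewrite ger0_norm//; nra.
    rewrite ltr0_norm// mulrNN; have := expR_ge0 u; lra.
(* The constant is the inverse of [G], so [G] must be positive: on [0, 1] the integrand is at least
   exp(- e). *)
have G0 : 0 < G.
  apply: (@lt_le_trans _ _ (\int[mu]_(u in `[0%R, 1%R]) (expR (- expR 1))%:E)).
    rewrite integral_cst//= lebesgue_measure_itv/= lte_fin ltr01 -EFinD -EFinM.
    by rewrite lte_fin mulr_gt0 ?expR_gt0// subr0.
  apply: (@le_trans _ _
    (\int[mu]_(u in `[0%R, 1%R]) (expR (nu * u - 1 * expR u))%:E)).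
    apply: ge0_le_integral => //.
    - by apply: measurable_funTS; exact: measurable_gamma_integrand.
    - move=> u; rewrite /= in_itv/= => /andP[u0 u1].
      rewrite lee_fin ler_expR mul1r.
      have : (expR u <= expR 1)%R by rewrite ler_expR.
      nra.
  apply: ge0_subset_integral => //.
  exact: measurable_gamma_integrand.
have [g g0 GE] : exists2 g : R, (0 < g)%R & G = g%:E.
  exists (fine G); first by rewrite fine_gt0// G0.
  by rewrite fineK// ge0_fin_numE// ltW.
exists g^-1%R; first by rewrite invr_gt0.
move=> x x0; have nx : (0 < `|x|)%R by rewrite normr_gt0.
have x2 : (expR (2 * ln `|x|) = x ^+ 2)%R.
  by rewrite mulrC expRM_natr lnK// real_normK// num_real.
suff -> : \int[mu]_u (expR (nu * u - x ^+ 2 * expR u))%:E =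
    (`|x| `^ (- (2 * nu)))%:E * G.
  by rewrite GE -!EFinM mulrCA mulVf ?gt_eqF// mulr1.
(* substitute u + 2 ln |x| for u, so that x^2 e^u becomes e^u *)
rewrite /G [in RHS](ge0_integral_affine (2 * ln `|x|)%R (oner_neq0 R));
  last 2 first.
- exact: measurable_gamma_integrand.
- by move=> u; rewrite lee_fin expR_ge0.
rewrite normr1 mul1e -ge0_integralZl//; last first.
  apply/measurable_EFinP; apply: measurableT_comp => //.
  have maff : measurable_fun setT (fun u : R => 1 * u + 2 * ln `|x|)%R.
    by apply: measurable_funD => //; exact: measurable_funM.
  apply: measurable_funB; apply: measurable_funM => //.
  exact: measurableT_comp.
apply: eq_integral => u _; rewrite -EFinM; congr EFin.
rewrite /powR gt_eqF// -expRD; congr expR.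
by rewrite !mul1r expRD x2; ring.
Qed.
End gamma.

(** * Standard Gaussian vectors *)

Definition mk_mfun d (T : measurableType d) (R : realType) (f : T -> R)
    (mf : measurable_fun setT f) : {mfun T >-> R} :=
  HB.pack f (isMeasurableFun.Build _ _ _ _ f mf).

Lemma mfunT d (T : measurableType d) (R : realType) (f : {mfun T >-> R}) :
  measurable_fun setT f.
Proof. exact: measurable_funP. Qed.

Section independence.
Local Open Scope ereal_scope.
Context d (T : measurableType d) (R : realType) (P : probability T R).
Local Notation N := (normal_prob (0 : R) 1).

(** Independence read as an equality of measures: the image by [U] of [P] restricted to [E] is [P E]
    times the normal law. *)
Lemma integral_indep_normal (E : set T) (U : {mfun T >-> R}) (h : R -> \bar R) :
  measurable E ->
  (forall A, measurable A -> P (E `&` U @^-1` A) = P E * N A) ->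
  measurable_fun setT h -> (forall x, 0 <= h x) ->
  \int[P]_w ((\1_E w)%:E * h (U w)) = P E * \int[N]_x h x.
Proof.
move=> mE indE mh h0.
have [nu nuE nuI] :=
  pushforward_measure (T' := measurableTypeR R) (mrestr P mE) (mfunT U).
have -> : \int[P]_w ((\1_E w)%:E * h (U w)) = \int[mrestr P mE]_w h (U w).
  symmetry; apply: (ge0_integral_density (mu := P) (f := \1_E)) => //.
  - by move=> B mB; rewrite integral_indic// /mrestr setIC.
  - by apply: (measurableT_comp mh); exact: mfunT.
have [e PE] : exists e, P E = e%:E.
  by exists (fine (P E)); rewrite fineK// fin_num_measure.
have e0 : (0 <= e)%R by rewrite -lee_fin -PE.
rewrite -nuI// PE -(ge0_integral_mscale N measurableT (NngNum e0))//.
apply: eq_measure_integral => B mB _; rewrite nuE.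
by rewrite -[LHS]/(P (U @^-1` B `&` E)) setIC indE// PE.
Qed.

Lemma integral_indep_normal2 (E : set T) (U V : {mfun T >-> R})
    (h : R * R -> \bar R) : measurable E ->
  (forall A B, measurable A -> measurable B ->
    P (E `&` (U @^-1` A `&` V @^-1` B)) = P E * (N A * N B)) ->
  measurable_fun setT h -> (forall z, 0 <= h z) ->
  \int[P]_w ((\1_E w)%:E * h (U w, V w)) = P E * \int[N]_x \int[N]_y h (x, y).
Proof.
move=> mE indE mh h0.
have mUV : measurable_fun setT (fun w => (U w, V w)).
  by apply: measurable_fun_pair; exact: mfunT.
have [nu nuE nuI] := pushforward_measure
  (T' := (measurableTypeR R * measurableTypeR R)%type) (mrestr P mE) mUV.
have -> : \int[P]_w ((\1_E w)%:E * h (U w, V w)) =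
    \int[mrestr P mE]_w h (U w, V w).
  symmetry; apply: (ge0_integral_density (mu := P) (f := \1_E)
    _ _ _ (g := fun w => h (U w, V w))) => //.
  - by move=> B mB; rewrite integral_indic// /mrestr setIC.
  - exact: (measurableT_comp mh mUV).
have [e PE] : exists e, P E = e%:E.
  by exists (fine (P E)); rewrite fineK// fin_num_measure.
have e0 : (0 <= e)%R by rewrite -lee_fin -PE.
(* The image measure is divided by [P E] to be compared with the product law on rectangles, so a
   null [E] is treated apart. *)
have [PE0|PE0] := eqVneq e 0%R.
  rewrite PE PE0 mul0e; apply: null_set_integral => //=.
  - exact: (measurableT_comp mh mUV).
  - by rewrite -[LHS]/(P (setT `&` E)) setTI PE PE0.
have PEV0 : (0 <= e^-1)%R by rewrite invr_ge0.
pose m := mscale (NngNum PEV0) nu.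
transitivity (P E * \int[m]_z h z).
  by rewrite ge0_integral_mscale// muleA nuI// PE -EFinM divff// mul1e.
congr (_ * _); have /= <- := fubini_tonelli1 (m1 := N) (m2 := N) h mh h0.
apply: eq_measure_integral => C mC _; apply/esym.
apply: product_measure_unique => //= A B mA mB.
rewrite -[LHS]/((e^-1)%:E * nu (A `*` B)) nuE.
rewrite -[X in _ * X = _]/(P ((U @^-1` A `&` V @^-1` B) `&` E)) setIC indE//.
by rewrite PE muleA -EFinM mulVf// mul1e.
Qed.

End independence.

Section standard.
Local Open Scope ereal_scope.
Context d (T : measurableType d) (R : realType) (P : probability T R) (k : nat).
Local Notation N := (normal_prob (0 : R) 1).
Implicit Types (Z : 'I_k -> {RV P >-> R}) (B : 'I_k -> set R).

Definition box Z B : set T := \bigcap_i (Z i @^-1` B i).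

Lemma measurable_box Z B : (forall i, measurable (B i)) -> measurable (box Z B).
Proof.
move=> mB; apply: fin_bigcap_measurable => // i _.
by rewrite -[X in measurable X]setTI; exact: (mfunT (Z i)).
Qed.

Lemma normal_setT : N setT = 1.
Proof. exact: probability_setT. Qed.

(** A single product formula on boxes replaces independence and marginal laws, and it is easy to
    check after a change of variables. The law of one coordinate is recovered by putting the full
    line elsewhere. *)
Lemma standard_gaussianP Z :
  standard_gaussian Z <->
  forall B, (forall i, measurable (B i)) -> P (box Z B) = \prod_(i < k) N (B i).
Proof.
split=> [[indZ lawZ] B mB|H].
  by rewrite [LHS]indZ//; apply: eq_bigr => i _; exact: lawZ.
have lawZ i (B : set R) : measurable B -> P (Z i @^-1` B) = N B.
  move=> mB; pose C j := if j == i then B else setT.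
  have -> : Z i @^-1` B = box Z C.
    apply/seteqP; split=> w /= => [BZ j _|/(_ i Logic.I)]; rewrite /C/=.
      by case: eqP => // ->.
    by rewrite eqxx.
  rewrite H; last by move=> j; rewrite /C; case: ifP.
  rewrite (bigD1 i)//= big1 ?mule1 /C ?eqxx// => j /negbTE ->.
  exact: normal_setT.
split=> [B mB|i B mB]; last exact: lawZ.
by rewrite [LHS]H//; apply: eq_bigr => i _; rewrite lawZ.
Qed.

(** With [A := setT] the constraint on coordinate [p] disappears, which leaves an event independent
    of that coordinate. *)
Definition upd B (p : 'I_k) (A : set R) i := if i == p then A else B i.

Lemma measurable_upd B p A : (forall i, measurable (B i)) -> measurable A ->
  forall i, measurable (upd B p A i).
Proof. by move=> mB mA i; rewrite /upd; case: ifP. Qed.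

Lemma box_upd Z B p A : box Z (upd B p A) = box Z (upd B p setT) `&` Z p @^-1` A.
Proof.
apply/seteqP; split=> w.
  move=> Zw; split=> [i _|].
    by have := Zw i Logic.I; rewrite /= /upd; case: ifP.
  by have := Zw p Logic.I; rewrite /= /upd eqxx.
move=> [Zw Zp] i _; have := Zw i Logic.I; rewrite /= /upd.
by case: eqP => // ->.
Qed.

Lemma prod_upd B p A : \prod_(i < k) N (upd B p A i) =
  (\prod_(i < k) N (upd B p setT i)) * N A.
Proof.
rewrite (bigD1 p)//= [in RHS](bigD1 p)//= /upd !eqxx normal_setT mul1e muleC.
by congr (_ * _); apply: eq_bigr => i /negbTE ->.
Qed.

Lemma box_indep Z B p A : standard_gaussian Z ->
  (forall i, measurable (B i)) -> measurable A ->
  P (box Z (upd B p setT) `&` Z p @^-1` A) = P (box Z (upd B p setT)) * N A.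
Proof.
move=> /standard_gaussianP HZ mB mA.
rewrite -box_upd (HZ _ (measurable_upd _ mB mA)).
by rewrite (HZ _ (measurable_upd _ mB measurableT)) prod_upd.
Qed.

Lemma box_indep2 Z B p q A C : standard_gaussian Z -> p != q ->
  (forall i, measurable (B i)) -> measurable A -> measurable C ->
  let E := box Z (upd (upd B p setT) q setT) in
  P (E `&` (Z p @^-1` A `&` Z q @^-1` C)) = P E * (N A * N C).
Proof.
move=> sZ pq mB mA mC E.
have updC A' C' : upd (upd B p A') q C' = upd (upd B q C') p A'.
  apply/funext => i; rewrite /upd; case: eqP => // ->.
  by rewrite eq_sym (negbTE pq).
rewrite setIA /E updC -box_upd -updC -box_upd.
move: sZ => /standard_gaussianP HZ.
rewrite (HZ _ (measurable_upd _ (measurable_upd _ mB mA) mC)).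
rewrite (HZ _ (measurable_upd _ (measurable_upd _ mB measurableT) measurableT)).
by rewrite prod_upd updC prod_upd -muleA -updC.
Qed.

End standard.

Section rotate.
Local Open Scope ereal_scope.
Context d (T : measurableType d) (R : realType) (P : probability T R) (k : nat).
Local Notation N := (normal_prob (0 : R) 1).

Lemma measurable_comb (U V : {mfun T >-> R}) (c s : R) :
  measurable_fun setT (fun w => c * U w + s * V w)%R.
Proof. by apply: measurable_funD; apply: measurable_funM => //; exact: mfunT. Qed.

Definition rotate (c s : R) (p q : 'I_k) (Z : 'I_k -> {RV P >-> R}) :
    'I_k -> {RV P >-> R} := fun i =>
  if i == p then mk_mfun (measurable_comb (Z p) (Z q) c s)
  else if i == q then mk_mfun (measurable_comb (Z p) (Z q) (- s) c) else Z i.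

(** A box of the rotated vector is an event [E] on the untouched coordinates intersected with an
    event on the pair (Z_p, Z_q). The pair is independent of [E] with law N x N, and
    [normal_rotation] removes the rotation. *)
Lemma standard_gaussian_rotate (c s : R) (p q : 'I_k)
    (Z : 'I_k -> {RV P >-> R}) :
  c != 0%R -> (c ^+ 2 + s ^+ 2 = 1)%R -> p != q ->
  standard_gaussian Z -> standard_gaussian (rotate c s p q Z).
Proof.
move=> c0 cs1 pq sZ; apply/standard_gaussianP => B mB.
set E := box Z (upd (upd B p setT) q setT).
have mE : measurable E by apply: measurable_box; do 2 apply: measurable_upd => //.
pose h z : \bar R := (\1_(B p `*` B q) z)%:E.
have mh : measurable_fun setT h.
  by apply/measurable_EFinP; apply: measurable_indic; exact: measurableX.
have h0 z : 0 <= h z by rewrite lee_fin.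
pose h' z := h (c * z.1 + s * z.2, - s * z.1 + c * z.2)%R.
have mh' : measurable_fun setT h'.
  exact: (measurableT_comp mh (measurable_lin2_pair _ _ _ _)).
have boxE : box (rotate c s p q Z) B = E `&`
    [set w | B p (c * Z p w + s * Z q w)%R /\ B q (- s * Z p w + c * Z q w)%R].
  have qp : q == p = false by rewrite eq_sym (negbTE pq).
  apply/seteqP; split=> w.
    move=> Zw; split=> [i _|].
      have := Zw i Logic.I; rewrite /= /rotate /upd.
      by case: (eqVneq i p) => [_ _|_]; case: (eqVneq i q).
    split.
      by have := Zw p Logic.I; rewrite /= /rotate eqxx.
    by have := Zw q Logic.I; rewrite /= /rotate qp eqxx.
  move=> [Zw [Bp Bq]] i _; have := Zw i Logic.I; rewrite /= /rotate /upd.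
  case: eqP => [->|_]; first by rewrite qp.
  by case: eqP => [->|].
transitivity (\int[P]_w ((\1_E w)%:E * h' (Z p w, Z q w))).
  rewrite -[box _ B]setIT -integral_indic//; last exact: measurable_box.
  apply: eq_integral => w _; rewrite boxE indicI EFinM; congr (_ * _).
rewrite (integral_indep_normal2 (P := P) mE _ mh' (fun=> h0 _)); last first.
  by move=> A C mA mC; exact: box_indep2.
rewrite normal_rotation//.
have -> : \int[N]_x \int[N]_y h (x, y) = N (B p) * N (B q).
  have /= <- := fubini_tonelli1 (m1 := N) (m2 := N) h mh h0.
  rewrite integral_indic ?setIT//; last exact: (measurableX (mB p) (mB q)).
  exact: (product_measure1E N N (mB p) (mB q)).
have /standard_gaussianP -> := sZ; last by do 2 apply: measurable_upd => //.
rewrite [in RHS](_ : B = upd (upd B p (B p)) q (B q)); last first.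
  by apply/funext => i; rewrite /upd; do 2 case: eqP => [->//|_].
rewrite [RHS]prod_upd muleA; congr (_ * _).
have updC A C : upd (upd B p A) q C = upd (upd B q C) p A.
  apply/funext => i; rewrite /upd; case: eqP => // ->.
  by rewrite eq_sym (negbTE pq).
by rewrite !updC [RHS]prod_upd.
Qed.
End rotate.

(** * Alignment of one coordinate of a Gaussian vector *)

Section align.
Context d (T : measurableType d) (R : realType) (P : probability T R) (n : nat).
Variables (X : 'I_n -> {RV P >-> R}) (Sigma : 'M[R]_n).

(** The body of [centered_gaussian] with its witnesses exposed, because alignment modifies both of
    them. *)
Definition represents k (A : 'M[R]_(n, k)) (Z : 'I_k -> {RV P >-> R}) :=
  [/\ standard_gaussian Z, A *m A^T = Sigma &
      {ae P, forall w, forall i, X i w = \sum_(j < k) A i j * Z j w}].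

Lemma sum_two_terms k (p q : 'I_k) (f g : 'I_k -> R) : p != q ->
  f p + f q = g p + g q -> (forall i, i != p -> i != q -> f i = g i) ->
  \sum_i f i = \sum_i g i.
Proof.
move=> pq fg2 fg; rewrite (bigD1 p)//= (bigD1 q) 1?eq_sym//= addrA fg2.
rewrite [RHS](bigD1 p)//= [in RHS](bigD1 q) 1?eq_sym//= addrA; congr (_ + _).
by apply: eq_bigr => i /andP[ip iq]; exact: fg.
Qed.

(** This is [A] times the transpose of the rotation applied to [Z], so that A Z and A A^T are both
    unchanged. *)
Definition rotate_mx k (c s : R) (p q : 'I_k) (A : 'M[R]_(n, k)) :=
  \matrix_(i, j) if j == p then c * A i p + s * A i q
    else if j == q then - s * A i p + c * A i q else A i j.

Lemma represents_rotate k (c s : R) (p q : 'I_k) A Z :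
  c != 0 -> c ^+ 2 + s ^+ 2 = 1 -> p != q ->
  represents A Z -> represents (rotate_mx c s p q A) (rotate c s p q Z).
Proof.
move=> c0 cs1 pq [sZ AAT aeX].
have qp : (q == p) = false by rewrite eq_sym (negbTE pq).
split; first exact: standard_gaussian_rotate.
- rewrite -AAT; apply/matrixP => i l; rewrite !mxE.
  apply: (sum_two_terms pq); last first.
    by move=> j /negbTE jp /negbTE jq; rewrite !mxE jp jq.
  rewrite !mxE !eqxx qp -[RHS]mul1r -cs1; ring.
- apply: filterS aeX => w Xw i; rewrite Xw; apply/esym/(sum_two_terms pq).
    rewrite !mxE /rotate !eqxx qp /= -[RHS]mul1r -cs1; ring.
  by move=> j /negbTE jp /negbTE jq; rewrite !mxE /rotate jp jq.
Qed.

(* Keeping a pivot [p] with [A i p != 0] and cancelling the other entries of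
   row [i] one at a time only needs rotations with nonzero cosine. *)
Lemma represents_align k A (Z : 'I_k -> {RV P >-> R}) (i : 'I_n) (p : 'I_k) :
  represents A Z -> A i p != 0 ->
  exists A' Z', [/\ represents A' Z', A' i p != 0 &
    forall q : 'I_k, q != p -> A' i q = 0].
Proof.
(* Induction on the number of nonzero entries of row [i] outside the pivot. *)
have [m] := ubnP #|[pred q | (q != p) && (A i q != 0)]|.
elim: m A Z => // m IH A Z; rewrite ltnS => Am AZ Ap.
have [q /andP[qp Aq]|none] := pickP [pred q | (q != p) && (A i q != 0)];
  last first.
  exists A, Z; split=> // q qp; have := none q; rewrite /= qp/=.
  by move/negbT; rewrite negbK => /eqP.
have pq : p != q by rewrite eq_sym.
(* The rotation with cosine a / r and sine b / r sends (a, b) to (r, 0), so the new pivot r is again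
   nonzero. *)
set a := A i p; set b := A i q; pose r := Num.sqrt (a ^+ 2 + b ^+ 2).
have r2gt0 : 0 < a ^+ 2 + b ^+ 2.
  by rewrite ltr_pwDl ?exprn_even_gt0// sqr_ge0.
have r2 : r ^+ 2 = a ^+ 2 + b ^+ 2 by rewrite sqr_sqrtr// ltW.
have r0 : r != 0 by rewrite gt_eqF// sqrtr_gt0.
have c0 : a / r != 0 by rewrite mulf_neq0// invr_eq0.
have cs1 : (a / r) ^+ 2 + (b / r) ^+ 2 = 1.
  by rewrite !exprMn !exprVn -mulrDl -r2 divff// expf_neq0.
apply: (IH _ _ _ (represents_rotate c0 cs1 pq AZ)); last first.
  rewrite !mxE eqxx -/a -/b.
  suff -> : a / r * a + b / r * b = r by [].
  by apply: (mulfI r0); rewrite -[RHS]expr2 r2; field.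
apply: leq_trans Am; apply: proper_card; apply/properP; split.
  apply/fintype.subsetP => j; rewrite !inE mxE => /andP[jp]; rewrite jp (negbTE jp).
  by have [->|//] := eqVneq j q; rewrite Aq.
exists q; first by rewrite inE qp.
rewrite inE mxE qp (negbTE qp) eqxx/= negbK -/a -/b.
by apply/eqP; ring.
Qed.

(** In such a representation X_i is almost surely a multiple of one normal coordinate, so a function
    of X_i is a function of one variable. A positive variance supplies the pivot. *)
Lemma centered_gaussian_align (i : 'I_n) :
  centered_gaussian X Sigma -> 0 < Sigma i i ->
  exists k (A : 'M[R]_(n, k)) Z (p : 'I_k),
    [/\ represents A Z, A i p != 0 , A i p ^+ 2 = Sigma i i &
        forall q, q != p -> A i q = 0].
Proof.
move=> [k [A [Z AZ]]] Sii.
have [p Ap|none] := pickP (fun p => A i p != 0); last first.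
  move: Sii; have [_ <- _] := AZ; rewrite mxE big1 ?ltxx// => j _.
  by move: (none j) => /negbFE/eqP ->; rewrite mul0r.
have [A' [Z' [AZ' Ap' Aq']]] := represents_align AZ Ap.
exists k, A', Z', p; split=> //.
have [_ <- _] := AZ'; rewrite mxE (bigD1 p)//= big1 ?addr0 ?mxE ?expr2// => j jp.
by rewrite Aq'// mul0r.
Qed.

End align.

(** * Absolute moments of a Gaussian coordinate *)

Section moments.
Local Open Scope ereal_scope.
Context d (T : measurableType d) (R : realType) (P : probability T R) (n : nat).
Local Notation N := (normal_prob (0 : R) 1).

Lemma measurable_absX_powR (a : R) :
  measurable_fun setT (fun x : R => (`|x| `^ a)%:E).
Proof.
apply/measurable_EFinP; apply: (measurableT_comp (measurable_powR _)).
exact: normr_measurable.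
Qed.

(** Only the dependence on the variance matters later, so the moment of the standard normal law
    stays an unevaluated integral. *)
Lemma gaussian_abs_moment (X : 'I_n -> {RV P >-> R}) (Sigma : 'M[R]_n) i nu :
  centered_gaussian X Sigma -> (0 < Sigma i i)%R ->
  'E_P[fun w => (`|X i w| `^ (2 * nu))%R] =
  (Sigma i i `^ nu)%:E * \int[N]_z (`|z| `^ (2 * nu))%:E.
Proof.
move=> gX Sii.
have [k [A [Z [p [[sZ AAT aeX] Ap A2 Aq]]]]] := centered_gaussian_align gX Sii.
rewrite unlock.
transitivity (\int[P]_w (`|(A i p * Z p w)%R| `^ (2 * nu))%:E).
  apply: ge0_ae_eq_integral => //.
  - exact: (measurableT_comp (measurable_absX_powR _) (mfunT (X i))).
  - apply: (measurableT_comp (measurable_absX_powR _)).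
    by apply: measurable_funM => //; exact: (mfunT (Z p)).
  - apply: filterS aeX => w Xw _; rewrite Xw (bigD1 p)//= big1 ?addr0// => j jp.
    by rewrite Aq// mul0r.
under eq_integral => w _.
  rewrite normrM powRM// powRrM powR_mulrn// real_normK ?num_real// A2 EFinM.
  over.
rewrite ge0_integralZl//; last 2 first.
- exact: (measurableT_comp (measurable_absX_powR _) (mfunT (Z p))).
- by rewrite lee_fin powR_ge0.
congr (_ * _).
have [nu' nuE nuI] :=
  pushforward_measure (T' := measurableTypeR R) P (mfunT (Z p)).
rewrite -(nuI _ (measurable_absX_powR (2 * nu))); last first.
  by move=> z; rewrite lee_fin powR_ge0.
by apply: eq_measure_integral => B mB _; rewrite nuE; have [_ /(_ p B mB)] := sZ.
Qed.
End moments.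

(** * Gaussian tilting *)

Section tilt.
Local Open Scope ereal_scope.
Context d (T : measurableType d) (R : realType) (P : probability T R).
Local Notation N := (normal_prob (0 : R) 1).

Lemma measurable_affine_mfun (U : {mfun T >-> R}) (c : R) :
  measurable_fun setT (fun w => c * U w)%R.
Proof. by apply: measurable_funM => //; exact: mfunT. Qed.

(** Typed with [mfun] and not with [RV P], because the dilated vector will be standard normal under
    a tilted law. *)
Definition dilate k (c : R) (p : 'I_k) (Z : 'I_k -> {mfun T >-> R}) :
    'I_k -> {mfun T >-> R} := fun i =>
  if i == p then mk_mfun (measurable_affine_mfun (Z p) c) else Z i.

Lemma measurable_gauss_kernel (t : R) (U : {mfun T >-> R}) :
  measurable_fun setT (fun w => expR (- t * U w ^+ 2))%R.
Proof.
apply: measurableT_comp => //; apply: measurable_funM => //.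
by apply: measurable_funX; exact: mfunT.
Qed.

(** The density a exp(-t Z_p^2) makes a Z_p standard normal by [normal_tilt]; by independence the
    other coordinates keep their joint law. *)
Lemma integral_box_dilate k (t : R) (p : 'I_k) (Z : 'I_k -> {RV P >-> R})
    (B : 'I_k -> set R) (a := Num.sqrt (1 + 2 * t)) : (0 <= t)%R ->
  standard_gaussian Z -> (forall i, measurable (B i)) ->
  \int[P]_(w in box (P := P) (dilate a p Z) B)
    (a * expR (- t * Z p w ^+ 2))%:E = \prod_(i < k) N (B i).
Proof.
move=> t0 sZ mB; have agt0 : (0 < a)%R by rewrite sqrtr_gt0; lra.
set E := box Z (upd B p setT).
have mE : measurable E by apply: measurable_box; exact: measurable_upd.
have boxE : box (P := P) (dilate a p Z) B = E `&` [set w | B p (a * Z p w)%R].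
  apply/seteqP; split=> w.
    move=> Zw; split=> [i _|].
      have := Zw i Logic.I; rewrite /= /dilate /upd.
      by case: (eqVneq i p).
    by have := Zw p Logic.I; rewrite /= /dilate eqxx.
  move=> [Zw Bp] i _; have := Zw i Logic.I; rewrite /= /dilate /upd.
  by case: (eqVneq i p) => [->|].
pose g z : \bar R := (a * \1_(B p) z)%:E.
have mg : measurable_fun setT g.
  by apply/measurable_EFinP; apply: measurable_funM => //; exact: measurable_indic.
have g0 z : 0 <= g z by rewrite lee_fin mulr_ge0// ltW.
pose h z := (expR (- t * z ^+ 2))%:E * g (a * z)%R.
have mh : measurable_fun setT h.
  apply: emeasurable_funM.
    apply/measurable_EFinP; apply: measurableT_comp => //.
    by apply: measurable_funM => //; exact: measurable_funX.
  by apply: (measurableT_comp mg); exact: measurable_funM.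
have h0 z : 0 <= h z by rewrite mule_ge0// lee_fin expR_ge0.
transitivity (\int[P]_w ((\1_E w)%:E * h (Z p w))).
  rewrite [LHS]integral_mkcond; apply: eq_integral => w _.
  rewrite epatch_indic boxE indicI /h /g/=.
  rewrite -[\1_[set _ | _] w]/(\1_(B p) (a * Z p w)%R) -!EFinM; congr EFin.
  ring.
rewrite (integral_indep_normal mE _ mh h0); last first.
  by move=> A mA; exact: box_indep.
rewrite (normal_tilt t0 mg g0) -/a.
have -> : \int[N]_x g x = a%:E * N (B p).
  under eq_integral => x _ do rewrite /g EFinM.
  rewrite ge0_integralZl//; last 2 first.
  - by apply/measurable_EFinP; apply: measurable_indic; exact: mB.
  - by rewrite lee_fin ltW.
  by rewrite integral_indic ?setIT//; exact: mB.
rewrite [X in _ * X = _]muleA -EFinM mulVf ?gt_eqF// mul1e.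
have /standard_gaussianP -> := sZ; last exact: measurable_upd.
rewrite -prod_upd; apply: eq_bigr => i _.
by rewrite /upd; case: eqP => // ->.
Qed.

(** After alignment of coordinate [j] the weight is exp(-t Z_p^2) with t = s S_jj, a function of Z_p
    alone. Its normalisation [Q] only shrinks the variance of Z_p, by the factor 1 / a^2. *)
Lemma gaussian_tilt n (X : 'I_n -> {RV P >-> R}) (Sigma : 'M[R]_n) (j : 'I_n)
    (s : R) :
  centered_gaussian X Sigma -> (0 < Sigma j j)%R -> (0 <= s)%R ->
  exists (Q : probability T R) (m c : R),
    [/\ (0 <= m)%R, (0 <= c)%R, (c * Sigma j j < 1)%R,
        centered_gaussian (P := Q) X
          (Sigma - c *: (col j Sigma *m row j Sigma)) &
        forall H : T -> \bar R, measurable_fun setT H -> (forall w, 0 <= H w) ->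
          \int[P]_w ((expR (- s * X j w ^+ 2))%:E * H w) =
          m%:E * \int[Q]_w H w].
Proof.
move=> gX Sjj s0.
have [k [A [Z [p [[sZ AAT aeX] Ap A2 Aq]]]]] := centered_gaussian_align gX Sjj.
pose t := (s * Sigma j j)%R; pose a := Num.sqrt (1 + 2 * t).
have t0 : (0 <= t)%R by rewrite mulr_ge0// ltW.
have a2 : (a ^+ 2 = 1 + 2 * t)%R by rewrite sqr_sqrtr//; lra.
have agt0 : (0 < a)%R by rewrite sqrtr_gt0; lra.
pose f w := (a * expR (- t * Z p w ^+ 2))%R.
have mf : measurable_fun setT f.
  by apply: measurable_funM => //; exact: measurable_gauss_kernel.
have f0 w : (0 <= f w)%R by rewrite mulr_ge0 ?expR_ge0// ltW.
have box1 : \int[P]_w (f w)%:E = 1.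
  have := integral_box_dilate p t0 sZ (B := fun=> setT) (fun=> measurableT).
  rewrite (_ : box _ _ = setT); last by rewrite /box bigcapT.
  by move=> ->; rewrite big1// => i _; exact: normal_setT.
have [Q QE] := probability_density mf f0 box1.
have QI := ge0_integral_density mf f0 (fun B _ => QE B).
(* Chosen so that c S_jj = 1 - 1 / a^2, the relative loss of variance of Z_p. *)
pose c := (2 * s / (1 + 2 * t))%R.
exists Q, a^-1%R, c; split.
- by rewrite invr_ge0 ltW.
- by rewrite divr_ge0//; lra.
- by rewrite /c mulrAC ltr_pdivrMr ?mul1r; move: t0; rewrite /t; lra.
(* Dividing column [p] by [a] compensates the dilation of Z_p, so [X] itself is unchanged. *)
- exists k, (\matrix_(i, l) if l == p then a^-1 * A i p else A i l)%R,
    (dilate a p Z).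
  split.
  + apply/standard_gaussianP => B mB; rewrite QE.
    exact: integral_box_dilate.
  + have SE i l : Sigma i l = (\sum_q A i q * A l q)%R.
      by rewrite -AAT mxE; apply: eq_bigr => q _; rewrite mxE.
    (* Row [j] of [A] vanishes outside [p], so the rank-one correction only involves column [p]. *)
    have Sj i : Sigma i j = (A i p * A j p)%R.
      rewrite SE (bigD1 p)//= big1 ?addr0// => q qp.
      by rewrite (Aq q)// mulr0.
    have jS i : Sigma j i = (A j p * A i p)%R.
      rewrite SE (bigD1 p)//= big1 ?addr0// => q qp.
      by rewrite (Aq q)// mul0r.
    have ca : (c * A j p ^+ 2 = 1 - a^-1 ^+ 2)%R.
      rewrite exprVn a2 /c A2 /t; field.
      by rewrite -/t; apply: lt0r_neq0; lra.
    apply/matrixP => i l; rewrite !mxE big_ord1 !mxE Sj jS SE.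
    rewrite (bigD1 p)//= [in RHS](bigD1 p)//= !mxE eqxx.
    have -> : (c * (A i p * A j p * (A j p * A l p)) =
      (c * A j p ^+ 2) * (A i p * A l p))%R by ring.
    rewrite ca addrAC; congr (_ + _)%R; first by ring.
    by apply: eq_bigr => q /negbTE qp; rewrite !mxE qp.
  (* [Q] has a density with respect to [P], so the exceptional set stays null. *)
  + have [E [mE PE0 subE]] := aeX; exists E; split.
    * exact: mE.
    * rewrite QE; apply: null_set_integral => //.
      by apply/measurable_EFinP; exact: measurable_funTS.
    * move=> w nXw; apply: subE => Xw; apply: nXw => i; rewrite Xw.
      apply: eq_bigr => l _; rewrite mxE /dilate; case: eqP => // ->/=.
      by field; rewrite gt_eqF.
- move=> H mH H0; rewrite QI// -ge0_integralZl//; last 3 first.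
  + by apply: emeasurable_funM => //; exact/measurable_EFinP.
  + by move=> w _; rewrite mule_ge0// lee_fin.
  + by rewrite lee_fin invr_ge0 ltW.
  apply: ge0_ae_eq_integral => //.
  + apply: emeasurable_funM => //; apply/measurable_EFinP.
    exact: measurable_gauss_kernel.
  + apply: measurable_funeM; apply: emeasurable_funM => //.
    exact/measurable_EFinP.
  + by move=> w _; rewrite mule_ge0// lee_fin expR_ge0.
  + by move=> w _; rewrite !mule_ge0// lee_fin// invr_ge0 ltW.
  + apply: filterS aeX => w Xw _; rewrite muleA -EFinM; congr (_%:E * _).
    rewrite /f mulKf ?gt_eqF//; congr expR.
    rewrite Xw (bigD1 p)//= big1 ?addr0; last by move=> q qp; rewrite Aq// mul0r.
    by rewrite exprMn A2 /t; ring.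
Qed.
End tilt.

(** * Quadratic forms and Schur complements *)

Section quadratic_form.
Context (R : realType) (d : nat).
Implicit Types (S : 'M[R]_d) (u v : 'cV[R]_d).

Definition bform S u v := (u^T *m S *m v) 0 0.
Definition qform S u := bform S u u.

Lemma bformC S u v : S^T = S -> bform S u v = bform S v u.
Proof.
move=> ST; have : (u^T *m S *m v)^T = v^T *m S *m u.
  by rewrite !trmx_mul ST trmxK mulmxA.
by move=> /matrixP/(_ 0 0); rewrite mxE.
Qed.

Lemma qformD S u v : S^T = S ->
  qform S (u + v) = qform S u + 2 * bform S u v + qform S v.
Proof.
move=> ST; rewrite /qform.
have -> : bform S (u + v) (u + v) =
    bform S u u + bform S u v + (bform S v u + bform S v v).
  by rewrite /bform [(u + v)^T]linearD /= !mulmxDl !mulmxDr !mxE.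
rewrite (bformC v u ST); ring.
Qed.

Lemma bformZr S u v a : bform S u (a *: v) = a * bform S u v.
Proof. by rewrite /bform -scalemxAr mxE. Qed.

Lemma qformZ S u a : qform S (a *: u) = a ^+ 2 * qform S u.
Proof.
by rewrite /qform /bform [(a *: u)^T]linearZ /= -scalemxAr -!scalemxAl !mxE mulrA.
Qed.

Lemma bform_delta S u j : bform S u (delta_mx j 0) = (u^T *m col j S) 0 0.
Proof. by rewrite /bform -mulmxA -colE. Qed.

Lemma qform_delta S j : qform S (delta_mx j 0) = S j j.
Proof.
rewrite /qform bform_delta trmx_delta -rowE !mxE.
by [].
Qed.

Definition tiltmx S c j : 'M[R]_d := S - c *: (col j S *m row j S).

Lemma qform_tiltmx S c j u : S^T = S ->
  qform (tiltmx S c j) u = qform S u - c * (bform S u (delta_mx j 0)) ^+ 2.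
Proof.
move=> ST; rewrite /qform {1}/bform /tiltmx mulmxBr mulmxBl mxE; congr (_ + _).
rewrite -scalemxAr -scalemxAl mxE mxE; congr (- (_ * _)).
rewrite (mulmxA u^T) -(mulmxA (u^T *m _)) [in LHS]mxE big_ord1 expr2; congr (_ * _).
  by rewrite bform_delta.
rewrite (bformC _ _ ST) /bform trmx_delta -rowE.
by [].
Qed.

(* [qform S u] is the variance of [\sum_l u_l X_l] when [X] has covariance [S],
   so [v k] bounds every [Var (X_i + \sum_(j in J) w_j X_j)], [i = enum_val k]. *)
Definition vlower_bound (J : {set 'I_d}) (v : 'I_#|~: J| -> R) S :=
  forall k u, u (enum_val k) 0 = 1 ->
    (forall l, l \notin J -> l != enum_val k -> u l 0 = 0) -> v k <= qform S u.

Section tilt.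
Variables (S : 'M[R]_d) (c : R) (j : 'I_d).
Hypotheses (pdS : posdefmx S) (c0 : 0 <= c) (cS : c * S j j < 1).

Let ST : S^T = S. Proof. by case: pdS. Qed.

Lemma posdefmx_diag_gt0 i : 0 < S i i.
Proof.
rewrite -qform_delta; case: pdS => _; apply.
apply/eqP => /matrixP/(_ i 0); rewrite !mxE !eqxx => /eqP.
by rewrite oner_eq0.
Qed.

Lemma posdefmx_qform_ge0 u : 0 <= qform S u.
Proof.
have [->|u0] := eqVneq u 0; last by apply: ltW; case: pdS => _; apply.
by rewrite /qform /bform mulmx0 mxE.
Qed.

(** The minimiser of the variance when [u] moves along coordinate [j]; [qform_min] gives the
    minimum. *)
Let x u := - (bform S u (delta_mx j 0)) / S j j.

Let qform_min u : qform S (u + x u *: delta_mx j 0) =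
  qform S u - (bform S u (delta_mx j 0)) ^+ 2 / S j j.
Proof.
rewrite qformD// bformZr qformZ qform_delta /x; field.
exact/lt0r_neq0/posdefmx_diag_gt0.
Qed.

Let c_ltV : c < (S j j)^-1.
Proof. by rewrite -[X in _ < X]mul1r ltr_pdivlMr// posdefmx_diag_gt0. Qed.

(** Put b = [bform S u (delta_mx j 0)]. Subtracting b^2 / S_jj leaves a nonnegative minimum, and c <
    1 / S_jj removes strictly less when b is nonzero; when b = 0 the form is that of [S]. *)
Lemma posdefmx_tilt : posdefmx (tiltmx S c j).
Proof.
split=> [|u u0].
  apply/matrixP => i l; rewrite !mxE !big_ord1 !mxE.
  have Ssym a b : S a b = S b a by rewrite -[in RHS]ST mxE.
  rewrite (Ssym l i) (Ssym l j) (Ssym j i); ring.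
rewrite -[X in 0 < X]/(qform _ u) qform_tiltmx// subr_gt0.
have := posdefmx_qform_ge0 (u + x u *: delta_mx j 0).
rewrite qform_min subr_ge0; set b := bform _ _ _.
have [->|b0] := eqVneq b 0.
  by rewrite expr0n/= mulr0 => _; case: pdS => _; apply.
by apply: lt_le_trans; rewrite mulrC ltr_pM2l// exprn_even_gt0.
Qed.

(** The constraints leave the coordinates in [J] free, so the bound for [S] may be used at the
    minimiser along [j]. There it gives q - b^2 / S_jj, which is at most the tilted value q - c
    b^2. *)
Lemma vlower_bound_tilt (J : {set 'I_d}) (v : 'I_#|~: J| -> R) : j \in J ->
  vlower_bound v S -> vlower_bound v (tiltmx S c j).
Proof.
move=> jJ vS k u uk ul.
have kj : enum_val k != j.
  by apply: contraTneq jJ => <-; have := enum_valP k; rewrite inE.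
have := vS k (u + x u *: delta_mx j 0).
rewrite qform_min qform_tiltmx// => /(_ _ _)/le_trans; apply.
- by rewrite !mxE uk (negbTE kj) mulr0 addr0.
- move=> l lJ lk; rewrite !mxE ul// (_ : l == j = false) ?mulr0 ?addr0//.
  by apply: contraNF lJ => /eqP ->.
- by rewrite lerD2l lerN2 mulrC ler_wpM2l ?sqr_ge0// ltW.
Qed.

End tilt.

Section schur.
Variables (S : 'M[R]_d) (J : {set 'I_d}).
Hypothesis pdS : posdefmx S.

Let ST : S^T = S. Proof. by case: pdS. Qed.

(** Extension by zero from [I], written as a matrix so that blocks of [S] become products in
    dimension [d]. *)
Definition selmx (I : {set 'I_d}) : 'M[R]_(d, #|I|) :=
  \matrix_(i, k) (i == enum_val k)%:R.

Lemma restrictmxE I I' : restrictmx I I' S = (selmx I)^T *m S *m selmx I'.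
Proof.
apply/matrixP => k l; rewrite !mxE.
rewrite (bigD1 (enum_val l))//= [X in _ = _ + X]big1 => [|i il]; last first.
  by rewrite [X in _ * X]mxE (negbTE il) mulr0.
rewrite [X in _ * X]mxE eqxx mulr1 addr0 mxE.
rewrite (bigD1 (enum_val k))//= big1 => [|i il]; last first.
  by rewrite !mxE (negbTE il) mul0r.
by rewrite !mxE eqxx mul1r addr0.
Qed.

Lemma selmx_orth I : (selmx I)^T *m selmx I = 1%:M.
Proof.
apply/matrixP => k l; rewrite !mxE (bigD1 (enum_val k))//= big1 => [|i il].
  by rewrite !mxE eqxx mul1r addr0 (inj_eq enum_val_inj).
by rewrite !mxE (negbTE il) mul0r.
Qed.

(** A kernel vector of the block, extended by zero, would be a nonzero vector on which the form of
    [S] vanishes. *)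
Lemma restrictmx_unit I : restrictmx I I S \in unitmx.
Proof.
rewrite -row_free_unit -kermx_eq0; apply/negPn/negP => /rowV0Pn[v].
move=> /sub_kermxP vS0 v0.
have Fv0 : selmx I *m v^T != 0.
  apply: contra_neq v0 => Fv; apply: trmx_inj; rewrite trmx0.
  by rewrite -[LHS]mul1mx -(selmx_orth I) -mulmxA Fv mulmx0.
case: pdS => _ /(_ _ Fv0); rewrite trmx_mul trmxK !mulmxA.
by rewrite -2!(mulmxA v) -restrictmxE vS0 mul0mx mxE ltxx.
Qed.

Lemma selmx_mul_out (I : {set 'I_d}) (y : 'cV[R]_#|I|) l :
  l \notin I -> (selmx I *m y) l 0 = 0.
Proof.
move=> lI; rewrite mxE big1// => m _; rewrite mxE (_ : _ == _ = false) ?mul0r//.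
by apply: contraNF lI => /eqP ->; exact: enum_valP.
Qed.

Lemma selmx_mul_in (I : {set 'I_d}) (y : 'cV[R]_#|I|) m :
  (selmx I *m y) (enum_val m) 0 = y m 0.
Proof.
rewrite mxE (bigD1 m)//= big1 ?addr0 => [|l lm]; first by rewrite mxE eqxx mul1r.
by rewrite mxE (inj_eq enum_val_inj) eq_sym (negbTE lm) mul0r.
Qed.

Section row.
Variable k : 'I_#|~: J|.
Let g : 'cV[R]_d := delta_mx (enum_val k) 0.
Let F := selmx J.
Let M := restrictmx J J S.
(** The regression coefficients of X_i on the X_j, j in [J], for i = [enum_val k]. Then [u0]
    describes the residual, and [FSu0] is the system of normal equations. *)
Let w := invmx M *m (F^T *m S *m g).
Let u0 := g - F *m w.

Let ME : F^T *m S *m F = M. Proof. by rewrite /M restrictmxE. Qed.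

Let FSu0 : F^T *m S *m u0 = 0.
Proof.
rewrite /u0 mulmxBr (mulmxA _ F) ME /w mulmxA mulmxV ?restrictmx_unit//.
by rewrite mul1mx subrr.
Qed.

Let schurE : schur_complement S J k k = bform S g u0.
Proof.
pose e : 'cV[R]_#|~: J| := delta_mx k 0.
have gE : g = selmx (~: J) *m e.
  rewrite /e -colE; apply/matrixP => i l; rewrite !mxE ord1 eqxx andbT.
  by [].
have eE (A : 'M[R]_#|~: J|) : A k k = (e^T *m A *m e) 0 0.
  by rewrite trmx_delta -rowE -colE !mxE.
rewrite eE /schur_complement mulmxBr mulmxBl -/M !restrictmxE -/F.
by rewrite /bform /u0 /w gE trmx_mul mulmxBr !mulmxA.
Qed.

(** The residual is uncorrelated with the X_j, so its covariance with X_i equals its own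
    variance. *)
Lemma schur_qform : schur_complement S J k k = qform S u0.
Proof.
rewrite schurE; apply/esym; rewrite /qform /bform.
have -> : u0^T = g^T - w^T *m F^T by rewrite {1}/u0 [LHS]linearB/= trmx_mul.
rewrite !mulmxBl -[w^T *m F^T *m S]mulmxA -[w^T *m _ *m _]mulmxA FSu0.
by rewrite mulmx0 subr0.
Qed.

Let kNJ : enum_val k \notin J.
Proof. by have := enum_valP k; rewrite inE. Qed.

Lemma schur_complement_gt0 : 0 < schur_complement S J k k.
Proof.
rewrite schur_qform; case: pdS => _; apply.
apply/eqP => /matrixP/(_ (enum_val k) 0); rewrite /u0 mxE [X in _ + X]mxE.
rewrite selmx_mul_out// subr0 !mxE !eqxx => /eqP; by rewrite oner_eq0.
Qed.

(** An admissible [u] differs from [u0] by a vector supported in [J], which is orthogonal to [u0]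
    for [S]; the rest is Pythagoras. *)
Lemma schur_complement_min u : u (enum_val k) 0 = 1 ->
  (forall l, l \notin J -> l != enum_val k -> u l 0 = 0) ->
  schur_complement S J k k <= qform S u.
Proof.
move=> uk ul; rewrite schur_qform.
pose y : 'cV[R]_#|J| := \col_m u (enum_val m) 0.
have -> : u = u0 + F *m (y + w).
  rewrite /u0 mulmxDr addrCA subrK; apply/matrixP => l i.
  rewrite ord1 mxE; have [lJ|lJ] := boolP (l \in J).
    rewrite -(enum_rankK_in lJ lJ) selmx_mul_in !mxE.
    rewrite (enum_rankK_in lJ lJ) (_ : l == _ = false) ?addr0//.
    by apply: contraNF kNJ => /eqP <-.
  rewrite selmx_mul_out// add0r mxE eqxx andbT.
  by have [->|lk] := eqVneq l (enum_val k); [rewrite uk|rewrite ul].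
rewrite qformD// bformC// {1}/bform trmx_mul -!mulmxA (mulmxA F^T) FSu0.
rewrite mulmx0 mxE mulr0 addr0 lerDl; exact: posdefmx_qform_ge0.
Qed.
End row.
End schur.
End quadratic_form.

(** * The mixture argument *)

Section gamma_swap.
Local Open Scope ereal_scope.
Context d (T : measurableType d) (R : realType) (P : probability T R).
Local Notation N := (normal_prob (0 : R) 1).
Local Notation mu := (@lebesgue_measure R).

(** The mixture formula fails at 0, where a nonzero power is 0 by convention while the integral
    diverges. *)
Lemma gaussian_ae_neq0 n (X : 'I_n -> {RV P >-> R}) (Sigma : 'M[R]_n) j :
  centered_gaussian X Sigma -> (0 < Sigma j j)%R -> {ae P, forall w, X j w != 0%R}.
Proof.
move=> gX Sjj.
have [k [A [Z [p [[sZ AAT aeX] Ap A2 Aq]]]]] := centered_gaussian_align gX Sjj.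
have Zp0 : {ae P, forall w, Z p w != 0%R}.
  exists (Z p @^-1` [set 0%R]); split.
  - by rewrite -[X in measurable X]setTI; exact: (mfunT (Z p)).
  - have [_ /(_ p [set 0%R] (measurable_set1 _)) lawZ] := sZ.
    rewrite [LHS]lawZ /normal_prob; apply: null_set_integral => //.
    + apply/measurable_EFinP; apply: measurable_funTS.
      exact: measurable_normal_pdf.
    + exact: lebesgue_measure_set1.
  - by move=> w /negP; rewrite negbK => /eqP.
apply: filterS2 aeX Zp0 => w Xw Zw.
rewrite Xw (bigD1 p)//= big1 ?addr0 ?mulf_neq0// => q qp.
by rewrite Aq// mul0r.
Qed.

(** [powRN_gamma] under the expectation, then Tonelli. The constant does not depend on [H], so it is
    common to both sides of the final inequality. *)
Lemma gamma_swap (U : {mfun T >-> R}) (nu : R) : (0 < nu < 2^-1)%R ->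
  {ae P, forall w, U w != 0%R} ->
  exists2 C : R, (0 < C)%R & forall H : T -> \bar R,
    measurable_fun setT H -> (forall w, 0 <= H w) ->
    \int[P]_w ((`|U w| `^ (- (2 * nu)))%:E * H w) =
    C%:E * \int[mu]_u ((expR (nu * u))%:E *
      \int[P]_w ((expR (- expR u * U w ^+ 2))%:E * H w)).
Proof.
move=> nu12 U0; have [C C0 CE] := powRN_gamma nu12.
exists C => // H mH H0.
pose h (z : T * R) : \bar R :=
  (expR (nu * z.2 - U z.1 ^+ 2 * expR z.2))%:E * H z.1.
have mU1 : measurable_fun setT (fun z : T * R => U z.1).
  by apply: (measurableT_comp (mfunT U)).
have mh : measurable_fun setT h.
  apply: emeasurable_funM; last exact: (measurableT_comp mH).
  apply/measurable_EFinP; apply: measurableT_comp => //.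
  apply: measurable_funB; first exact: measurable_funM.
  apply: measurable_funM; first exact: measurable_funX.
  exact: measurableT_comp.
have h0 z : 0 <= h z by rewrite mule_ge0// lee_fin expR_ge0.
transitivity (\int[P]_w (C%:E * \int[mu]_u h (w, u))).
  apply: ge0_ae_eq_integral => //.
  - apply: emeasurable_funM => //.
    exact: (measurableT_comp (measurable_absX_powR _) (mfunT U)).
  - apply: measurable_funeM.
    exact: (measurable_fun_fubini_tonelli_F (m2 := mu) _ mh h0).
  - by move=> w _; rewrite mule_ge0// lee_fin powR_ge0.
  - move=> w _; apply: mule_ge0; first by rewrite lee_fin ltW.
    exact: integral_ge0.
  - apply: filterS U0 => w Uw _; rewrite CE// -muleA; congr (_ * _).
    rewrite muleC -ge0_integralZl//.
    + by apply: eq_integral => u _; rewrite muleC.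
    + exact: measurable_gamma_integrand.
rewrite ge0_integralZl//; last 3 first.
- exact: (measurable_fun_fubini_tonelli_F (m2 := mu) _ mh h0).
- by move=> w _; exact: integral_ge0.
- by rewrite lee_fin ltW.
congr (_ * _).
have -> := fubini_tonelli (m1 := P) (m2 := mu) h mh h0.
apply: eq_integral => u _; rewrite -ge0_integralZl//; last 2 first.
- apply: emeasurable_funM => //; apply/measurable_EFinP.
  exact: measurable_gauss_kernel.
- by move=> w _; rewrite mule_ge0// lee_fin expR_ge0.
apply: eq_integral => w _; rewrite muleA -EFinM -expRD /h/=.
by congr ((expR _)%:E * _); ring.
Qed.
End gamma_swap.

Lemma measurable_bigprod d (T : measurableType d) (R : realType) (I : Type)
    (r : seq I) (Q : pred I) (f : I -> T -> R) :
  (forall i, measurable_fun setT (f i)) ->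
  measurable_fun setT (fun w => \prod_(i <- r | Q i) f i w).
Proof.
move=> mf; elim: r => [|i r IHr];
  first by under eq_fun do rewrite big_nil; exact: measurable_cst.
under eq_fun do rewrite big_cons.
case: (Q i); last exact: IHr.
exact: (measurable_funM (mf i) IHr).
Qed.

Lemma lee_prod_ge0 (R : realType) (I : Type) (r : seq I) (Q : pred I)
    (f g : I -> \bar R) : (forall i, 0 <= f i)%E -> (forall i, f i <= g i)%E ->
  (\prod_(i <- r | Q i) f i <= \prod_(i <- r | Q i) g i)%E.
Proof.
move=> f0 fg.
suff /andP[] : (0 <= \prod_(i <- r | Q i) f i <= \prod_(i <- r | Q i) g i)%E by [].
apply: (big_rec2 (fun x y => (0 <= x <= y)%E)); first by rewrite lee01 lexx.
by move=> i x y _ /andP[x0 xy]; rewrite mule_ge0//= lee_pmul.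
Qed.

(** * Induction on the negative powers *)

Section induction.
Local Open Scope ereal_scope.
Context d (T : measurableType d) (R : realType) (n : nat).
Variables (X : 'I_n -> {mfun T >-> R}) (J : {set 'I_n}) (nu : 'I_n -> R).
Variable v : 'I_#|~: J| -> R.
Hypothesis v0 : forall k, (0 <= v k)%R.
Hypothesis nu_J : forall j, j \in J -> (0 <= nu j < 2^-1)%R.
Hypothesis nu_JC : forall i, i \in ~: J -> (0 < nu i)%R.
Hypothesis gpi : GPI (fun k : 'I_#|~: J| => nu (enum_val k)).

Local Notation N := (normal_prob (0 : R) 1).
Local Notation mu := (@lebesgue_measure R).

(** Built from the lower bounds [v] and not from a law, so it stays the same through all the
    tilts. *)
Let K := \prod_(k < #|~: J|) ((v k `^ nu (enum_val k))%:E *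
  \int[N]_z (`|z| `^ (2 * nu (enum_val k)))%:E).

Let K0 : 0 <= K.
Proof.
apply: prode_ge0 => k _; rewrite mule_ge0 ?lee_fin ?powR_ge0//.
by apply: integral_ge0 => z _; rewrite lee_fin powR_ge0.
Qed.

Lemma centered_gaussian_restrict (P : probability T R) (Sigma : 'M[R]_n) :
  centered_gaussian (P := P) X Sigma ->
  centered_gaussian (P := P) (fun k : 'I_#|~: J| => X (enum_val k))
    (restrictmx (~: J) (~: J) Sigma).
Proof.
move=> [k [A [Z [sZ AAT aeX]]]]; exists k, (rowsub enum_val A), Z; split=> //.
- rewrite -AAT; apply/matrixP => i l; rewrite !mxE.
  by apply: eq_bigr => q _; rewrite !mxE.
- apply: filterS aeX => w Xw i; rewrite Xw; apply: eq_bigr => q _.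
  by rewrite mxE.
Qed.

Let F w := (\prod_(i in ~: J) `|X i w| `^ (2 * nu i))%R.
Let G (l : seq 'I_n) w := (\prod_(j <- l) `|X j w| `^ (- (2 * nu j)))%R.

Lemma measurable_abs_powR i a : measurable_fun setT (fun w => `|X i w| `^ a)%R.
Proof.
apply: (measurableT_comp (measurable_powR _)).
exact: (measurableT_comp (@normr_measurable _ _) (mfunT (X i))).
Qed.

Let mF : measurable_fun setT F.
Proof. by apply: measurable_bigprod => i _; exact: measurable_abs_powR. Qed.

Let mG l : measurable_fun setT (G l).
Proof. by apply: measurable_bigprod => i _; exact: measurable_abs_powR. Qed.

Let F0 w : (0 <= F w)%R. Proof. by apply: prodr_ge0 => i _; exact: powR_ge0. Qed.
Let G0 l w : (0 <= G l w)%R.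
Proof. by apply: prodr_ge0 => i _; exact: powR_ge0. Qed.

(** The case without negative powers: the moments produced by [gpi] increase with the variances, and
    the unit vector in [vlower_bound] shows that each variance is at least [v k]. *)
Lemma gpi_bound (P : probability T R) Sigma : posdefmx Sigma ->
  centered_gaussian (P := P) X Sigma -> vlower_bound v Sigma ->
  K <= \int[P]_w (F w)%:E.
Proof.
move=> pdS gX vS; have := gpi (centered_gaussian_restrict gX).
rewrite [in X in _ <= X -> _]unlock => H.
have -> : \int[P]_w (F w)%:E =
    \int[P]_w (\prod_(i < #|~: J|) `|X (enum_val i) w| `^ (2 * nu (enum_val i)))%:E.
  by apply: eq_integral => w _; rewrite /F big_enum_val.
apply: le_trans H; rewrite /K.
apply: lee_prod_ge0 => k.
  rewrite mule_ge0 ?lee_fin ?powR_ge0//.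
  by apply: integral_ge0 => z _; rewrite lee_fin powR_ge0.
rewrite (gaussian_abs_moment _ gX) ?posdefmx_diag_gt0//.
apply: lee_wpmul2r; first by apply: integral_ge0 => z _; rewrite lee_fin powR_ge0.
have Sk : (v k <= Sigma (enum_val k) (enum_val k))%R.
  rewrite -qform_delta; apply: vS => [|l _ lk]; rewrite mxE ?eqxx//.
  by rewrite (negbTE lk).
rewrite lee_fin ge0_ler_powR// ?nnegrE ?(le_trans _ Sk)//.
by rewrite ltW// nu_JC// enum_valP.
Qed.

(** Induction on [l], with [P] and [Sigma] general because each step passes to a tilted law and its
    covariance. *)
Lemma weighted_bound l (P : probability T R) Sigma : {subset l <= J} ->
  posdefmx Sigma -> centered_gaussian (P := P) X Sigma -> vlower_bound v Sigma ->
  K * \int[P]_w (G l w)%:E <= \int[P]_w (G l w * F w)%:E.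
Proof.
elim: l P Sigma => [|j l IH] P Sigma lJ pdS gX vS.
  rewrite /G; under eq_integral do rewrite big_nil.
  under [leRHS]eq_integral do rewrite big_nil mul1r.
  rewrite integral_cst// mul1e -[X in _ * X <= _]/(P setT).
  rewrite (_ : P setT = 1) ?mule1; last exact: probability_setT.
  exact: gpi_bound pdS gX vS.
have jJ : j \in J by apply: lJ; rewrite inE eqxx.
have lJ' : {subset l <= J} by move=> i il; apply: lJ; rewrite inE il orbT.
(* The gamma formula needs a positive exponent; for exponent 0 the factor is 1 everywhere, even at
   the origin. *)
have [nuj0|nuj0] := eqVneq (nu j) 0%R.
  have -> : G (j :: l) = G l.
    by apply/funext => w; rewrite /G big_cons nuj0 mulr0 oppr0 powRr0 mul1r.
  exact: IH pdS gX vS.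
have nuj : (0 < nu j < 2^-1)%R.
  by have /andP[n0 ->] := nu_J jJ; rewrite lt_def nuj0 n0.
have Sjj := posdefmx_diag_gt0 pdS j.
have [C C0 CE] := gamma_swap nuj (gaussian_ae_neq0 gX Sjj).
have mGl : measurable_fun setT (fun w => (G l w)%:E) by exact/measurable_EFinP.
have mGF : measurable_fun setT (fun w => (G l w * F w)%:E).
  by apply/measurable_EFinP; exact: measurable_funM.
have GF0 w : 0 <= (G l w * F w)%:E by rewrite lee_fin mulr_ge0.
pose ker (H : T -> \bar R) (z : R * T) :=
  (expR (- expR z.1 * X j z.2 ^+ 2))%:E * H z.2.
have mker H : measurable_fun setT H -> measurable_fun setT (ker H).
  move=> mH; apply: emeasurable_funM; last exact: (measurableT_comp mH).
  apply/measurable_EFinP; apply: measurableT_comp => //.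
  apply: measurable_funM.
    by do 2 apply: measurableT_comp => //.
  by apply: measurable_funX; exact: (measurableT_comp (mfunT (X j))).
have ker0 H z : (forall w, 0 <= H w) -> 0 <= ker H z.
  by move=> H0; rewrite mule_ge0// lee_fin expR_ge0.
pose I H u := (expR (nu j * u))%:E * \int[P]_w ker H (u, w).
have mI H : measurable_fun setT H -> (forall w, 0 <= H w) ->
    measurable_fun setT (I H).
  move=> mH H0; apply: emeasurable_funM.
    by apply/measurable_EFinP; apply: measurableT_comp => //; exact: measurable_funM.
  exact: (measurable_fun_fubini_tonelli_F (m2 := P) _ (mker _ mH)
    (fun z => ker0 _ z H0)).
have I0 H u : (forall w, 0 <= H w) -> 0 <= I H u.
  move=> H0; rewrite mule_ge0 ?lee_fin ?expR_ge0// integral_ge0// => w _.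
  exact: ker0.
have gammaE (H : T -> R) : measurable_fun setT H -> (forall w, (0 <= H w)%R) ->
    \int[P]_w (`|X j w| `^ (- (2 * nu j)) * H w)%:E =
    C%:E * \int[mu]_u I (EFin \o H) u.
  move=> mH H0; rewrite -CE; last 2 first.
  - exact/measurable_EFinP.
  - by move=> w; rewrite lee_fin.
  by apply: eq_integral => w _; rewrite EFinM.
have -> : \int[P]_w (G (j :: l) w)%:E = C%:E * \int[mu]_u I (EFin \o G l) u.
  by rewrite -gammaE//; apply: eq_integral => w _; rewrite /G big_cons.
have -> : \int[P]_w (G (j :: l) w * F w)%:E =
    C%:E * \int[mu]_u I (EFin \o (G l \* F)%R) u.
  have mGFr : measurable_fun setT (G l \* F)%R.
    exact: (measurable_funM (mG l) mF).
  rewrite -(gammaE _ mGFr) => [|w]; last by rewrite mulr_ge0.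
  by apply: eq_integral => w _; rewrite /G big_cons mulrA.
rewrite muleCA; apply: lee_wpmul2l; first by rewrite lee_fin ltW.
have Gl0 w : 0 <= (G l w)%:E by rewrite lee_fin.
have mIG := mI _ mGl Gl0; have mIGF := mI _ mGF GF0.
rewrite -ge0_integralZl//; last by move=> u _; exact: I0.
apply: ge0_le_integral => //.
- by move=> u _; rewrite mule_ge0//; exact: I0.
- exact: measurable_funeM.
move=> u _; rewrite /I muleCA; apply: lee_wpmul2l; first by rewrite lee_fin expR_ge0.
(* For fixed u the weight has s = e^u. Both sides become [m] times an expectation under [Q], where
   the induction hypothesis applies. *)
have [Q [m [c [m0 c0 cS gQ QE]]]] := gaussian_tilt gX Sjj (expR_ge0 u).
rewrite [X in _ * X](QE (EFin \o G l))// [leRHS](QE (EFin \o (G l \* F)%R))//.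
rewrite muleCA; apply: lee_wpmul2l; first by rewrite lee_fin.
apply: (IH Q _ lJ' _ gQ).
- exact: posdefmx_tilt.
- exact: vlower_bound_tilt.
Qed.
End induction.

Theorem theorem1 (R : realType) (d : nat) (dsp : measure_display)
    (T : measurableType dsp) (P : probability T R)
    (X : 'I_d -> {RV P >-> R}) (Sigma : 'M[R]_d)
    (J : {set 'I_d}) (nu : 'I_d -> R)
    (Sigma_posdef : posdefmx Sigma)
    (X_gaussian : centered_gaussian X Sigma)
    (J_nonempty : J != finset.set0)
    (J_proper : J \proper finset.setT)
    (nu_J : forall j, j \in J -> 0 <= nu j < 2^-1)
    (nu_JC : forall i, i \in ~: J -> 0 < nu i)
    (gpi : GPI (fun k : 'I_#|~: J| => nu (enum_val k))) :
  ('E_P[fun w => (\prod_(j in J) `|X j w| `^ (- (2 * nu j)) *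
                  \prod_(i in ~: J) `|X i w| `^ (2 * nu i))%R] >=
   'E_P[fun w => (\prod_(j in J) `|X j w| `^ (- (2 * nu j)))%R] *
   \prod_(k < #|~: J|)
     let i := enum_val k in
     (((schur_complement Sigma J k k / Sigma i i) `^ nu i)%R%:E *
      'E_P[fun w => (`|X i w| `^ (2 * nu i))%R]))%E.
Proof.
set v := fun k : 'I_#|~: J| => schur_complement Sigma J k k.
have v_gt0 k : 0 < v k by exact: schur_complement_gt0.
have vS : vlower_bound v Sigma.
  by move=> k u uk ul; exact: schur_complement_min.
have enumJ : {subset enum J <= J} by move=> j; rewrite mem_enum.
have := weighted_bound (fun k => ltW (v_gt0 k)) nu_J nu_JC gpi
  enumJ Sigma_posdef X_gaussian vS.
have expectationE (f : T -> R) : ('E_P[f] = \int[P]_w (f w)%:E)%E.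
  by rewrite unlock.
rewrite [X in _ -> (_ <= X)%E]expectationE.
rewrite [X in _ -> (X * _ <= _)%E]expectationE.
under eq_integral do rewrite big_enum.
under [X in (_ <= X)%E -> _]eq_integral do rewrite big_enum.
congr (_ <= _)%E; rewrite muleC; congr (_ * _)%E; apply: eq_bigr => k _ /=.
have Skk := posdefmx_diag_gt0 Sigma_posdef (enum_val k).
rewrite (gaussian_abs_moment _ X_gaussian Skk) muleA -EFinM.
(* The variance S_ii of the moment cancels the denominator of the ratio, leaving the power of [v k]
   that occurs in the constant of [weighted_bound]. *)
rewrite -powRM ?divfK ?gt_eqF//; last exact: ltW.
exact: (divr_ge0 (ltW (v_gt0 k)) (ltW Skk)).
Qed.
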